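(* Consider the system, measurement constraints and recursive algorithm described in the context. If $\boldsymbol x_k$ satisfies the system equation (with $\boldsymbol x_0\in\mathcal E(\hat{\boldsymbol x}_0,\varsigma_0P_0)$ and $\boldsymbol\nu_k\in[-1,1]^m$) and meets the measurement constraints, then for all $k\in\mathbb N^*$ $$\boldsymbol x_k\in\mathcal S_k\subseteq\mathcal E_k:=\mathcal E(\hat{\boldsymbol x}_k,\varsigma_kP_k),$$ where $\mathcal S_k$ is the intersection of the predicted ellipsoid $\mathcal E(\hat{\boldsymbol x}_{k/k-1},\varsigma_{k-1}P_{k/k-1})$ with all the measurement sets at time $k$, and $(\hat{\boldsymbol x}_k,\varsigma_k,P_k)$ is given by the prediction and correction formulas of the context.
   Context: **Notation.** $\mathcal E(\boldsymbol c,P):=\{\boldsymbol c+P^{1/2}\boldsymbol z:\|\boldsymbol z\|\le1\}$ for $P$ symmetric positive semi-definite (possibly degenerate ellipsoid); $\mathcal G(\boldsymbol d,a):=\{\boldsymbol x:\boldsymbol x^T\boldsymbol d\le a\}$; $\mathcal H(\boldsymbol d,a):=\{\boldsymbol x:\boldsymbol x^T\boldsymbol d=a\}$; $\|\cdot\|$ is the Euclidean norm. **System.** For $k\in\mathbb N^*$, $\boldsymbol x_k=A_{k-1}\boldsymbol x_{k-1}+B_{k-1}\boldsymbol\tau_{k-1}+R_{k-1}\boldsymbol\nu_{k-1}$ in $\mathbb R^n$, with known $A_k\in\mathbb R^{n\times n}$, $B_k\in\mathbb R^{n\times l}$, $R_k=[\boldsymbol r_{k_1},\dots,\boldsymbol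 r_{k_m}]\in\mathbb R^{n\times m}$, $\boldsymbol\tau_k\in\mathbb R^l$, unknown $\boldsymbol\nu_k\in[-1,1]^m$ and $\boldsymbol x_0\in\mathcal E(\hat{\boldsymbol x}_0,\varsigma_0P_0)$, $P_0$ symmetric positive definite, $\varsigma_0>0$. **Measurements.** At each time $k$ there are $p_k\in\mathbb N$ (possibly $0$) measurements $\underline y_{k_i}\le\boldsymbol f_{k_i}^T\boldsymbol x_k\le\bar y_{k_i}$, $i\in\{1,\dots,p_k\}$, with $\boldsymbol f_{k_i}\in\mathbb R^n$. The index set $\{1,\dots,p_k\}$ is partitioned into $\mathscr D_k$ (both bounds finite, $\underline y_{k_i}<\bar y_{k_i}$), $\bar{\mathscr G}_k$ ($\underline y_{k_i}=-\infty$, $\bar y_{k_i}$ finite), $\underline{\mathscr G}_k$ ($\bar y_{k_i}=+\infty$, $\underline y_{k_i}$ finite) and $\mathscr H_k$ ($\underline y_{k_i}=\bar y_{k_i}$ finite); $\mathscr G_k:=\bar{\mathscr G}_k\cup\underline{\mathscr G}_k$. Measurement sets: $\mathcal G_{k_i}:=\mathcal G(\boldsymbol f_{k_i},\bar y_{k_i})$ for $i\in\bar{\mathscr G}_k$, $\mathcal G_{k_i}:=\mathcal G(-\boldsymbol f_{k_i},-\underline y_{k_i})$ for $i\in\underline{\mathscr G}_k$, $\mathcal H_{k_i}:=\mathcal H(\boldsymbol f_{k_i},\bar y_{k_i})$ for $i\in\mathscr H_k$, $\mathcal D_{k_i}:=\{\boldsymbol x:\underline y_{k_i}\le\boldsymbol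 f_{k_i}^T\boldsymbol x\le\bar y_{k_i}\}$ for $i\in\mathscr D_k$. **Standing assumptions.** All known matrices and vectors, $P_0$ and $\varsigma_0$ are bounded; all columns of the matrices in the system equation and all $\boldsymbol f_{k_i}$ are nonzero; the matrix $[\boldsymbol f_{k_i}]_{i\in\mathscr H_k}$ has full column rank. **Prediction.** $\hat{\boldsymbol x}_{k/k-1}:=A_{k-1}\hat{\boldsymbol x}_{k-1}+B_{k-1}\boldsymbol\tau_{k-1}$, $P_{k/k-1_0}:=A_{k-1}P_{k-1}A_{k-1}^T$, $\bar\mu_{{k-1}_0}:=\sqrt{\varsigma_{k-1}\operatorname{tr}(P_{k/k-1_0})}$, $\bar\mu_{k-1}:=\sum_{i=1}^m\|\boldsymbol r_{{k-1}_i}\|$, $\bar R_{k-1}:=\sum_{i=1}^m\|\boldsymbol r_{{k-1}_i}\|^{-1}\boldsymbol r_{{k-1}_i}\boldsymbol r_{{k-1}_i}^T$, $$P_{k/k-1}:=\Big(1+\frac{\bar\mu_{k-1}}{\bar\mu_{{k-1}_0}}\Big)\Big(P_{k/k-1_0}+\frac{\bar\mu_{{k-1}_0}}{\varsigma_{k-1}}\bar R_{k-1}\Big).$$ **Set $\mathcal S_k$.** $\mathcal S_k:=\mathcal E(\hat{\boldsymbol x}_{k/k-1},\varsigma_{k-1}P_{k/k-1})\cap\bigcap_{i\in\mathscr G_k}\mathcal G_{k_i}\cap\bigcap_{i\in\mathscr D_k}\mathcal D_{k_i}\cap\bigcap_{i\in\mathscr H_k}\mathcal H_{k_i}$. **Correction.**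 Start from $\varsigma_{k_0}:=\varsigma_{k-1}$, $P_{k_0}:=P_{k/k-1}$, $\hat{\boldsymbol x}_{k_0}:=\hat{\boldsymbol x}_{k/k-1}$. For $i=1,\dots,p_k$ set $\boldsymbol\varphi_{k_i}:=P_{k_{i-1}}\boldsymbol f_{k_i}$, $\theta_{k_i}:=\boldsymbol f_{k_i}^T\boldsymbol\varphi_{k_i}$, $\lambda_{k_i}:=(\varsigma_{k_{i-1}}\theta_{k_i})^{1/2}$, $\bar\rho_{k_i}:=\lambda_{k_i}+\boldsymbol f_{k_i}^T\hat{\boldsymbol x}_{k_{i-1}}$, $\underline\rho_{k_i}:=2\lambda_{k_i}-\bar\rho_{k_i}$, clipped bounds $\bar y'_{k_i}:=\min(\bar y_{k_i},\bar\rho_{k_i})$, $\underline y'_{k_i}:=\max(\underline y_{k_i},-\underline\rho_{k_i})$, $\delta_{k_i}:=\tfrac12(\bar y'_{k_i}+\underline y'_{k_i}-\bar\rho_{k_i}+\underline\rho_{k_i})$, $\gamma_{k_i}:=\tfrac12(\bar y'_{k_i}-\underline y'_{k_i})$; $\alpha_{k_i}:=\theta_{k_i}^{-1}$ if $p_k\ne0$ and $\lambda_{k_i}\ne0$, and $\alpha_{k_i}:=0$ otherwise; $$\beta_{k_i}:=\begin{cases}1&\text{if }\underline y'_{k_i}=\bar y'_{k_i}\text{ and }-\underline\rho_{k_i}\ne\bar\rho_{k_i},\\1-\gamma_{k_i}|\delta_{k_i}|^{-1}&\text{else if }|\delta_{k_i}|>\gamma_{k_i}\text{ and }(-\underline\rho_{k_i}<\underline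 y'_{k_i}\text{ or }\bar y'_{k_i}<\bar\rho_{k_i}),\\0&\text{otherwise;}\end{cases}$$ $$P_{k_i}:=P_{k_{i-1}}-\alpha_{k_i}\beta_{k_i}\boldsymbol\varphi_{k_i}\boldsymbol\varphi_{k_i}^T,\quad\hat{\boldsymbol x}_{k_i}:=\hat{\boldsymbol x}_{k_{i-1}}+\alpha_{k_i}\beta_{k_i}\delta_{k_i}\boldsymbol\varphi_{k_i},\quad\varsigma_{k_i}:=\varsigma_{k_{i-1}}-\alpha_{k_i}\beta_{k_i}^2\delta_{k_i}^2.$$ Finally $\varsigma_k:=\varsigma_{k_{p_k}}$, $P_k:=P_{k_{p_k}}$, $\hat{\boldsymbol x}_k:=\hat{\boldsymbol x}_{k_{p_k}}$.
   Formalization: The claim at time k is stated under the extra assumption that the denominators μ̄_{j_0} = sqrt(ς_j tr(A_j P_j A_j^T)) are nonzero for all j < k; otherwise (e.g. P_j = 0 after n independent equality measurements) the prediction formula is undefined. *)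

(* Defs.v *)
From mathcomp Require Import all_boot all_order all_algebra.
From mathcomp Require Import all_classical all_reals.

Set Implicit Arguments.
Unset Strict Implicit.
Unset Printing Implicit Defensive.

Import Order.TTheory GRing.Theory Num.Theory.
Local Open Scope classical_set_scope.
Local Open Scope ring_scope.

Definition dotv (R : realType) (n : nat) (u v : 'cV[R]_n) : R :=
  (u^T *m v) 0 0.

(* The library's norm `|v| on matrices is the sup norm, hence this one. *)
Definition enorm (R : realType) (n : nat) (v : 'cV[R]_n) : R :=
  Num.sqrt (dotv v v).

Definition psdmx (R : realType) (n : nat) (P : 'M[R]_n) : Prop :=
  P^T = P /\ forall v : 'cV[R]_n, 0 <= dotv v (P *m v).

Definition pdmx (R : realType) (n : nat) (P : 'M[R]_n) : Prop :=
  P^T = P /\ forall v : 'cV[R]_n, v != 0 -> 0 < dotv v (P *m v).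

(* Q = P^{1/2}: for P symmetric positive semi-definite there is exactly one
   such Q; otherwise there is none, and [ellipsoid c P] is empty. *)
Definition is_psd_sqrt (R : realType) (n : nat) (P Q : 'M[R]_n) : Prop :=
  psdmx Q /\ Q *m Q = P.

Definition ellipsoid (R : realType) (n : nat) (c : 'cV[R]_n) (P : 'M[R]_n) :
    set 'cV[R]_n :=
  [set x | exists Q z, [/\ is_psd_sqrt P Q, enorm z <= 1 & x = c + Q *m z]].

Definition halfspace (R : realType) (n : nat) (d : 'cV[R]_n) (a : R) :
    set 'cV[R]_n := [set x | dotv x d <= a].

Definition hyperplane (R : realType) (n : nat) (d : 'cV[R]_n) (a : R) :
    set 'cV[R]_n := [set x | dotv x d = a].

(* Measurements at time k are indexed by 'I_(nmeas k) (from 0, not from 1);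
   the data [nmeas], [fmeas], [ylo], [yhi] are only meaningful for k >= 1. *)
Record model (R : realType) (n l m : nat) := Model {
  Amx : nat -> 'M[R]_n;
  Bmx : nat -> 'M[R]_(n, l);
  Rmx : nat -> 'M[R]_(n, m);
  tau : nat -> 'cV[R]_l;
  nmeas : nat -> nat;
  fmeas : forall k, 'I_(nmeas k) -> 'cV[R]_n;
  ylo : forall k, 'I_(nmeas k) -> \bar R;
  yhi : forall k, 'I_(nmeas k) -> \bar R;
  xhat0 : 'cV[R]_n;
  Pinit : 'M[R]_n;
  sigma0 : R }.

Section Model.
Context (R : realType) (n l m : nat) (d : model R n l m).

(* The four classes of measurements; being defined from the bounds they are
   pairwise disjoint. *)
Definition idxD k : {set 'I_(nmeas d k)} :=
  [set i | [&& ylo i \is a fin_num, yhi i \is a fin_num & (ylo i < yhi i)%E]]%SET.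

Definition idxGup k : {set 'I_(nmeas d k)} :=
  [set i | (ylo i == -oo%E) && (yhi i \is a fin_num)]%SET.

Definition idxGlo k : {set 'I_(nmeas d k)} :=
  [set i | (yhi i == +oo%E) && (ylo i \is a fin_num)]%SET.

Definition idxH k : {set 'I_(nmeas d k)} :=
  [set i | (ylo i == yhi i) && (ylo i \is a fin_num)]%SET.

Definition idxG k : {set 'I_(nmeas d k)} := (idxGup k :|: idxGlo k)%SET.

Definition measG k (i : 'I_(nmeas d k)) : set 'cV[R]_n :=
  if i \in idxGup k then halfspace (fmeas i) (fine (yhi i))
  else halfspace (- fmeas i) (- fine (ylo i)).

Definition measH k (i : 'I_(nmeas d k)) : set 'cV[R]_n :=
  hyperplane (fmeas i) (fine (yhi i)).

Definition measD k (i : 'I_(nmeas d k)) : set 'cV[R]_n :=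
  [set x | fine (ylo i) <= dotv (fmeas i) x <= fine (yhi i)].

Definition Hmx k : 'M[R]_(n, #|idxH k|) :=
  \matrix_(a < n, j < #|idxH k|) fmeas (enum_val j) a 0.

Record standing_assumptions : Prop := StandingAssumptions {
  Pinit_pd : pdmx (Pinit d);
  sigma0_gt0 : 0 < sigma0 d;
  data_bounded : exists M : R, forall k,
    [/\ forall a b, `|Amx d k a b| <= M,
        forall a b, `|Bmx d k a b| <= M,
        forall a b, `|Rmx d k a b| <= M,
        forall a, `|tau d k a 0| <= M
      & (0 < k)%N -> forall (i : 'I_(nmeas d k)) a, `|fmeas i a 0| <= M];
  Amx_col_neq0 : forall k j, col j (Amx d k) != 0;
  Bmx_col_neq0 : forall k j, col j (Bmx d k) != 0;
  Rmx_col_neq0 : forall k j, col j (Rmx d k) != 0;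
  fmeas_neq0 : forall k, (0 < k)%N ->
    forall i : 'I_(nmeas d k), fmeas i != 0;
  meas_classes : forall k, (0 < k)%N ->
    (idxD k :|: idxGup k :|: idxGlo k :|: idxH k = [set: 'I_(nmeas d k)])%SET;
  Hmx_full_col_rank : forall k, (0 < k)%N -> \rank (Hmx k) = #|idxH k| }.

Definition trajectory (x : nat -> 'cV[R]_n) (nu : nat -> 'cV[R]_m) : Prop :=
  [/\ x 0%N \in ellipsoid (xhat0 d) (sigma0 d *: Pinit d),
      forall k a, -1 <= nu k a 0 <= 1
    & forall k, (0 < k)%N ->
        x k = Amx d k.-1 *m x k.-1 + Bmx d k.-1 *m tau d k.-1
              + Rmx d k.-1 *m nu k.-1].

Definition meets_measurements (x : nat -> 'cV[R]_n) : Prop :=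
  forall k, (0 < k)%N -> forall i : 'I_(nmeas d k),
    (ylo i <= (dotv (fmeas i) (x k))%:E <= yhi i)%E.

(* The algorithm's state (\hat x, P, \varsigma). *)
Record estimate := Estimate {
  ctr : 'cV[R]_n;
  shp : 'M[R]_n;
  scl : R }.

Definition est_ellipsoid (e : estimate) : set 'cV[R]_n :=
  ellipsoid (ctr e) (scl e *: shp e).

(* In the prediction, [k] stands for the "k-1" of the formulas. *)
Definition pred_shp0 k (e : estimate) : 'M[R]_n :=
  Amx d k *m shp e *m (Amx d k)^T.

Definition mubar0 k (e : estimate) : R :=
  Num.sqrt (scl e * \tr (pred_shp0 k e)).

Definition mubar k : R := \sum_(i < m) enorm (col i (Rmx d k)).

Definition Rbar k : 'M[R]_n :=
  \sum_(i < m) (enorm (col i (Rmx d k)))^-1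
                 *: (col i (Rmx d k) *m (col i (Rmx d k))^T).

Definition predict k (e : estimate) : estimate :=
  Estimate (Amx d k *m ctr e + Bmx d k *m tau d k)
    ((1 + mubar k / mubar0 k e)
       *: (pred_shp0 k e + (mubar0 k e / scl e) *: Rbar k))
    (scl e).

(* One pass of the correction loop.  Here nmeas k != 0 because of i, so the
   condition p_k <> 0 in the definition of alpha is automatic.  The clipped
   bounds yh and yl are finite under [standing_assumptions], so that [fine]
   loses nothing. *)
Definition correct1 k (e : estimate) (i : 'I_(nmeas d k)) : estimate :=
  let f := fmeas i in
  let phi := shp e *m f in
  let theta := dotv f phi in
  let lambda := Num.sqrt (scl e * theta) in
  let rhoh := lambda + dotv f (ctr e) in
  let rhol := 2 * lambda - rhoh in
  let yh := fine (Order.min (yhi i) rhoh%:E) in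
  let yl := fine (Order.max (ylo i) (- rhol)%:E) in
  let delta := (yh + yl - rhoh + rhol) / 2 in
  let gamma := (yh - yl) / 2 in
  let alpha := if lambda != 0 then theta^-1 else 0 in
  let beta :=
    if (yl == yh) && (- rhol != rhoh) then 1
    else if (gamma < `|delta|) && ((- rhol < yl) || (yh < rhoh))
    then 1 - gamma * `|delta|^-1
    else 0 in
  Estimate (ctr e + (alpha * beta * delta) *: phi)
    (shp e - (alpha * beta) *: (phi *m phi^T))
    (scl e - alpha * beta ^+ 2 * delta ^+ 2).

Definition correct k (e : estimate) : estimate :=
  foldl (@correct1 k) e (enum 'I_(nmeas d k)).

Fixpoint filter_est (k : nat) : estimate :=
  if k is k'.+1 then correct k'.+1 (predict k' (filter_est k'))
  else Estimate (xhat0 d) (Pinit d) (sigma0 d).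

(* S_k and E_k; [setS] is meant for k >= 1. *)
Definition setS (k : nat) : set 'cV[R]_n :=
  est_ellipsoid (predict k.-1 (filter_est k.-1))
  `&` \bigcap_(i in [set` idxG k]) measG i
  `&` \bigcap_(i in [set` idxD k]) measD i
  `&` \bigcap_(i in [set` idxH k]) measH i.

Definition setE (k : nat) : set 'cV[R]_n := est_ellipsoid (filter_est k).

(* The prediction formulas leading to times 1, ..., k divide by mubar0 and by
   the scale of the current estimate.  Both are nonzero exactly when mubar0
   is. *)
Definition prediction_defined (k : nat) : Prop :=
  forall j, (j < k)%N -> mubar0 j (filter_est j) != 0.

End Model.

(* Main.v *)
(** A point x lies in the (possibly degenerate) ellipsoid E(c, Q) iff Q is
    symmetric and (u . (x - c))^2 <= u . Q u for every u; this support form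
    needs no inverse of Q.  Both steps of the filter then reduce to the scalar
    inequality (a + b)^2 <= (N + A)(X + q), valid when a^2 <= N X and
    b^2 <= A q.  In the prediction, a comes from the previous ellipsoid and b
    from the zonotope of the noise.  In the correction, u is split into a
    multiple of f and a P-orthogonal remainder, and the weight beta is such
    that (t - beta delta)^2 <= (1 - beta)(t^2 - beta^2 delta^2) for every
    value t = f . (x - c) allowed by the clipped measurement. *)

Require Import Defs.
From mathcomp Require Import all_boot all_order all_algebra.
From mathcomp Require Import all_classical all_reals.
From mathcomp Require Import complex ring lra.

Set Implicit Arguments.
Unset Strict Implicit.
Unset Printing Implicit Defensive.

Import Order.TTheory GRing.Theory Num.Theory.
Local Open Scope classical_set_scope.
Local Open Scope ring_scope.

(** * Polynomial interpolation and polynomials in a matrix *)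

Lemma poly_interp (F : fieldType) (f : F -> F) (s : seq F) :
  exists p : {poly F}, forall x, x \in s -> p.[x] = f x.
Proof.
elim: s => [|a s [p hp]]; first by exists 0.
have [as_|as_] := boolP (a \in s).
  by exists p => x; rewrite inE => /orP[/eqP->|]; apply: hp.
(* [q] vanishes on [s] but not at [a], so adding a multiple of it repairs the value at [a] and keeps
   the others. *)
pose q := \prod_(y <- s) ('X - y%:P).
have qa : q.[a] != 0 by rewrite -/(root q a) root_prod_XsubC.
exists (p + ((f a - p.[a]) / q.[a]) *: q) => x; rewrite !hornerE inE.
move=> /orP[/eqP->|xs]; first by rewrite divfK// subrKC.
have /eqP -> : root q x by rewrite root_prod_XsubC.
by rewrite mulr0 addr0 hp.
Qed.

Lemma trmx_horner_mx (F : comNzRingType) (n : nat) (A : 'M[F]_n.+1)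
    (p : {poly F}) : (horner_mx A p)^T = horner_mx A^T p.
Proof.
elim/poly_ind: p => [|p c IH]; first by rewrite !rmorph0 trmx0.
rewrite !rmorphD !rmorphM /= !horner_mx_X !horner_mx_C linearD /= tr_scalar_mx.
congr (_ + _); rewrite -mulmxE trmx_mul IH.
exact: (comm_mx_horner p (erefl : comm_mx A^T A^T)).
Qed.

(** * Algebra of the dot product *)

Section Dot.
Context (R : realType) (n : nat).
Implicit Types (u v w : 'cV[R]_n) (P : 'M[R]_n).

Lemma dotvE u v : dotv u v = \sum_i u i 0 * v i 0.
Proof. by rewrite /dotv mxE; apply: eq_bigr => i _; rewrite mxE. Qed.

Lemma dotvC u v : dotv u v = dotv v u.
Proof. by rewrite !dotvE; apply: eq_bigr => i _; rewrite mulrC. Qed.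

Lemma dotvDr u v w : dotv u (v + w) = dotv u v + dotv u w.
Proof. by rewrite /dotv mulmxDr mxE. Qed.

Lemma dotvZr u v a : dotv u (a *: v) = a * dotv u v.
Proof. by rewrite /dotv -scalemxAr mxE. Qed.

Lemma dotvDl u v w : dotv (v + w) u = dotv v u + dotv w u.
Proof. by rewrite !(dotvC _ u) dotvDr. Qed.

Lemma dotvZl u v a : dotv (a *: v) u = a * dotv v u.
Proof. by rewrite !(dotvC _ u) dotvZr. Qed.

Lemma dotvBr u v w : dotv u (v - w) = dotv u v - dotv u w.
Proof. by rewrite dotvDr -scaleN1r dotvZr mulN1r. Qed.

Lemma dotv0 u : dotv u 0 = 0.
Proof. by rewrite /dotv mulmx0 mxE. Qed.

Lemma dotv_sumr (I : Type) (r : seq I) u (F : I -> 'cV[R]_n) :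
  dotv u (\sum_(i <- r) F i) = \sum_(i <- r) dotv u (F i).
Proof.
by elim/big_ind2: _ => [|? ? ? ? <- <-|//]; rewrite ?dotv0// dotvDr.
Qed.

Lemma dotvv_ge0 u : 0 <= dotv u u.
Proof. by rewrite dotvE sumr_ge0// => i _; rewrite -expr2 sqr_ge0. Qed.

Lemma dotvv_eq0 u : (dotv u u == 0) = (u == 0).
Proof.
apply/eqP/eqP => [|->]; last exact: dotv0.
rewrite dotvE => /eqP; rewrite psumr_eq0; last first.
  by move=> i _; rewrite -expr2 sqr_ge0.
move=> /allP u0; apply/matrixP => i j; rewrite ord1 mxE; apply/eqP.
by have := u0 i (mem_index_enum _); rewrite /= mulf_eq0 orbb.
Qed.

End Dot.

Lemma dotv_mulmx (R : realType) (m n : nat) (u : 'cV[R]_m) (A : 'M[R]_(m, n))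
  (v : 'cV[R]_n) : dotv u (A *m v) = dotv (A^T *m u) v.
Proof. by rewrite /dotv trmx_mul trmxK mulmxA. Qed.

(** * Spectral calculus and square roots of positive semi-definite matrices *)

Lemma psd_eigenvalue_ge0 (R : realType) (n : nat) (P : 'M[R]_n) (a : R) :
  psdmx P -> eigenvalue P a -> 0 <= a.
Proof.
move=> [Psym Ppos] /eigenvalueP[v vP v0].
have vv : 0 < dotv v^T v^T.
  by rewrite lt_def dotvv_ge0 dotvv_eq0 trmx_eq0 v0.
rewrite -(pmulr_lge0 _ vv) -dotvZr; have := Ppos v^T.
by rewrite -[P in P *m _]trmxK -trmx_mul Psym vP linearZ.
Qed.

(** Over the complex numbers the symmetric [P] is unitarily diagonalizable, so [p(P)] is similar to
    the diagonal matrix of the values of [p] at the eigenvalues. *)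
Lemma psd_horner_eq0 (R : realType) (n : nat) (P : 'M[R]_n.+1) (p : {poly R}) :
  psdmx P -> (forall a, 0 <= a -> eigenvalue P a -> p.[a] = 0) ->
  horner_mx P p = 0.
Proof.
move=> Ppsd p0; pose toC := real_complex R; pose A := map_mx toC P.
have Areal : A \is a mxOver Num.real.
  by apply/mxOverP => i j; rewrite mxE; apply/complex_realP; exists (P i j).
have Asym : A \is symmetricmx.
  apply/is_hermitianmxP; rewrite expr0 scale1r map_mx_id//.
  by rewrite map_trmx Ppsd.1.
have Aherm := realsym_hermsym Asym Areal.
have /orthomx_spectralP := hermitian_normalmx Aherm.
set U := spectralmx A; set D := spectral_diag A => AE.
have Uunit : U \in unitmx := spectral_unit A.
(* Diagonal entries of a hermitian matrix's spectrum are real; row [i] of [U] is a left eigenvector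
   of [A], which makes the entry an eigenvalue of [P] itself. *)
have Dreal i : exists2 a, D 0 i = toC a & eigenvalue P a.
  have /mxOverP/(_ 0 i)/complex_realP[a Da] := hermitian_spectral_diag_real Aherm.
  exists a; first exact: Da.
  rewrite -(eigenvalue_map toC) -/A; apply/eigenvalueP; exists (row i U).
    rewrite -row_mul AE !mulmxA mulmxV// mul1mx row_mul row_diag_mx.
    by rewrite -scalemxAl -rowE -/D Da.
  apply/eqP => Ui0; have /row_freeP[V UV] : row_free U by rewrite row_free_unit.
  have := congr1 (row i) UV; rewrite row_mul Ui0 mul0mx => /rowP/(_ i).
  by rewrite !mxE eqxx => /esym/eqP; rewrite oner_eq0.
apply: (map_mx_inj (f := toC)) => //.
rewrite map_horner_mx -/A AE horner_mx_uconjC// horner_mx_diag.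
suff -> : map_mx (horner (map_poly toC p)) D = 0.
  by rewrite linear0 mulmx0 mul0mx map_mx0.
apply/rowP => i; rewrite !mxE; have [a -> aP] := Dreal i.
by rewrite horner_map p0 ?rmorph0//; exact: psd_eigenvalue_ge0 aP.
Qed.

Lemma psdmx_sqr (R : realType) (n : nat) (Q : 'M[R]_n) :
  Q^T = Q -> psdmx (Q *m Q).
Proof.
move=> Qsym; split; first by rewrite trmx_mul Qsym.
by move=> v; rewrite -mulmxA dotv_mulmx Qsym dotvv_ge0.
Qed.

(* Interpolating the fourth root at the eigenvalues gives a polynomial [q] with
   [q(P)^4 = P]; the square root is [q(P)^2], which is visibly psd. *)
Lemma psd_sqrt_exists (R : realType) (n : nat) (P : 'M[R]_n) :
  psdmx P -> exists Q, is_psd_sqrt P Q.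
Proof.
case: n P => [|n] P Ppsd.
  by exists P; split=> //; apply/matrixP => -[].
(* Interpolation needs a finite list containing the eigenvalues; the real parts of all complex roots
   of the characteristic polynomial form one. *)
have [s sP] : exists s : seq R, forall a, eigenvalue P a -> a \in s.
  have [s sE] := closed_field_poly_normal (map_poly (real_complex R) (char_poly P)).
  exists (map (@complex.Re R) s) => a.
  rewrite eigenvalue_root_char -(fmorph_root (real_complex R)) sE.
  rewrite rootZ ?root_prod_XsubC; last first.
    by rewrite lead_coef_eq0 map_poly_eq0 monic_neq0// char_poly_monic.
  by move=> /(map_f (@complex.Re R)).
have [q qP] := poly_interp (fun a => Num.sqrt (Num.sqrt a)) s.
have q4 : horner_mx P (q ^+ 4 - 'X) = 0.
  apply: psd_horner_eq0 => // a a0 /sP /qP; rewrite !hornerE => ->.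
  by rewrite (exprM _ 2 2) !sqr_sqrtr ?sqrtr_ge0// subrr.
have qsym : (horner_mx P q)^T = horner_mx P q.
  by rewrite trmx_horner_mx Ppsd.1.
exists (horner_mx P q *m horner_mx P q); split; first exact: psdmx_sqr.
move: q4 => /eqP; rewrite rmorphB subr_eq0 /= horner_mx_X => /eqP q4.
by rewrite -[RHS]q4 !mulmxE -!rmorphM /= -!expr2 -exprM.
Qed.

(** * Cauchy-Schwarz inequalities and the support form of ellipsoids *)

Lemma sqrD_leM (R : realFieldType) (a b N X A q : R) :
  0 <= N -> 0 <= X -> 0 <= A -> 0 <= q ->
  a ^+ 2 <= N * X -> b ^+ 2 <= A * q -> (a + b) ^+ 2 <= (N + A) * (X + q).
Proof.
move=> N0 X0 A0 q0 aNX bAq.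
(* The cross term obeys (a b)^2 <= (A X)(N q), so this is the arithmetic-geometric mean inequality
   for [A * X] and [N * q]. *)
suff : 2 * (a * b) <= A * X + N * q by nra.
apply: le_trans (ler_norm _) _.
rewrite -ler_sqr ?nnegrE ?addr_ge0 ?mulr_ge0// real_normK ?num_real// !exprMn.
have := ler_pM (sqr_ge0 a) (sqr_ge0 b) aNX bAq.
by have := sqr_ge0 (A * X - N * q); nra.
Qed.

Lemma sqr_sum_leM (R : realFieldType) (I : Type) (r : seq I) (a X Y : I -> R) :
  (forall i, 0 <= X i) -> (forall i, 0 <= Y i) ->
  (forall i, a i ^+ 2 <= X i * Y i) ->
  (\sum_(i <- r) a i) ^+ 2 <= (\sum_(i <- r) X i) * (\sum_(i <- r) Y i).
Proof.
move=> X0 Y0 aXY; elim: r => [|i r IH]; first by rewrite !big_nil expr0n mul0r.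
by rewrite !big_cons sqrD_leM ?sumr_ge0.
Qed.

Lemma dotv_CauchySchwarz (R : realType) (n : nat) (u v : 'cV[R]_n) :
  dotv u v ^+ 2 <= dotv u u * dotv v v.
Proof.
by rewrite !dotvE sqr_sum_leM// => i; rewrite -?expr2 ?sqr_ge0 ?exprMn.
Qed.

Lemma enorm_ge0 (R : realType) (n : nat) (v : 'cV[R]_n) : 0 <= enorm v.
Proof. exact: sqrtr_ge0. Qed.

Lemma enorm_sqr (R : realType) (n : nat) (v : 'cV[R]_n) :
  enorm v ^+ 2 = dotv v v.
Proof. by rewrite sqr_sqrtr// dotvv_ge0. Qed.

Lemma ellipsoidP (R : realType) (n : nat) (c : 'cV[R]_n) (Q : 'M[R]_n) x :
  ellipsoid c Q x <->
  Q^T = Q /\ forall u, dotv u (x - c) ^+ 2 <= dotv u (Q *m u).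
Proof.
split=> [[S [z [[[Ssym Spos] <-] z1 ->]]]|[Qsym xQ]].
  split=> [|u]; first by rewrite trmx_mul Ssym.
  rewrite addrC addKr -mulmxA dotv_mulmx [leRHS]dotv_mulmx Ssym.
  apply: le_trans (dotv_CauchySchwarz _ _) _.
  rewrite ler_piMr ?dotvv_ge0// -enorm_sqr.
  by rewrite expr_le1 ?enorm_ge0.
have Qpsd : psdmx Q by split=> // u; apply: le_trans (xQ u); rewrite sqr_ge0.
have [S [[Ssym Spos] SQ]] := psd_sqrt_exists Qpsd.
(* For [u] in the kernel of [Q] the hypothesis forces u . (x - c) = 0; hence x - c is in the range
   of the symmetric [Q]. *)
have [v xv] : exists v, x - c = Q *m v.
  suff /submxP[v xv] : ((x - c)^T <= Q)%MS.
    by exists v^T; rewrite -[LHS]trmxK xv trmx_mul Qsym.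
  rewrite submxE; apply/eqP/rowP => j; rewrite [RHS]mxE.
  have := xQ (col j (cokermx Q)).
  have -> : Q *m col j (cokermx Q) = 0.
    by rewrite colE mulmxA mulmx_coker mul0mx.
  rewrite dotv0 => xQ0.
  have : dotv (col j (cokermx Q)) (x - c) ^+ 2 == 0 by rewrite eq_le xQ0 sqr_ge0.
  rewrite sqrf_eq0 dotvC => /eqP; rewrite /dotv colE mulmxA -colE.
  by rewrite mxE.
(* With z = S v one has x - c = S z, and the hypothesis at u = v reads |z|^4 <= |z|^2. *)
exists S, (S *m v); split=> //; last by rewrite mulmxA SQ -xv addrC subrK.
have /= := xQ v; rewrite xv -SQ -mulmxA dotv_mulmx Ssym -enorm_sqr.
move=> e4; rewrite -(@expr_le1 _ 2) ?enorm_ge0//.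
by have := enorm_ge0 (S *m v); nra.
Qed.

(** The correction inequality in the plane spanned by [f] and one direction [u]: [th], [a], [r] are
    the Gram entries f.Pf, u.Pf, u.Pu, while [t] and [g] are the products of f and u with x - c. *)
Lemma shrink_scalar (R : realFieldType) (s th t g a r be de : R) :
  0 < th -> 0 <= be <= 1 -> 0 <= t ^+ 2 - be ^+ 2 * de ^+ 2 ->
  (t - be * de) ^+ 2 <= (1 - be) * (t ^+ 2 - be ^+ 2 * de ^+ 2) ->
  (forall x y,
     0 <= x ^+ 2 * th + 2 * x * y * a + y ^+ 2 * r /\
     (x * t + y * g) ^+ 2 <= s * (x ^+ 2 * th + 2 * x * y * a + y ^+ 2 * r)) ->
  (g - th^-1 * be * de * a) ^+ 2 <=
  (s - th^-1 * be ^+ 2 * de ^+ 2) * (r - th^-1 * be * a ^+ 2).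
Proof.
move=> th0 be01 N0 tbe H; have thN0 := lt0r_neq0 th0.
(* u - z f is P-orthogonal to f; [b] is its product with x - c and [q] its squared P-length. In
   these coordinates the quadratic form is diagonal. *)
pose z := a / th; have az : a = z * th by rewrite divfK.
pose b := g - z * t; pose q := r - z ^+ 2 * th.
have {}H x y : (x * t + y * b) ^+ 2 <= s * (x ^+ 2 * th + y ^+ 2 * q) /\
    0 <= x ^+ 2 * th + y ^+ 2 * q.
  have [] := H (x - y * z) y.
  by rewrite /b /q az; split; nra.
have q0 : 0 <= q by have [_] := H 0 1; lra.
have s0 : 0 <= s.
  have [] := H 1 0; have := sqr_ge0 t; nra.
(* The direction f uses up t^2 / th of the scale; what is left bounds the orthogonal component. *)
have bq : b ^+ 2 <= (s - t ^+ 2 / th) * q.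
  have -> : (s - t ^+ 2 / th) * q = (s * th * q - t ^+ 2 * q) / th by field.
  (* [x = t q, y = b th] maximises (x t + y b)^2 / (x^2 th + y^2 q). *)
  rewrite ler_pdivlMr//; have [] := H (t * q) (b * th).
  pose M := t ^+ 2 * q + b ^+ 2 * th.
  have -> : t * q * t + b * th * b = M by rewrite /M; ring.
  have -> : s * ((t * q) ^+ 2 * th + (b * th) ^+ 2 * q) = s * th * q * M.
    by rewrite /M; ring.
  have M0 : 0 <= M by rewrite addr_ge0// mulr_ge0 ?sqr_ge0// ltW.
  move=> MM _; suff : M <= s * th * q by rewrite /M; lra.
  move: M0; rewrite le_eqVlt => /predU1P[<-|Mpos].
    by rewrite !mulr_ge0// ltW.
  by rewrite -(ler_pM2r Mpos) -expr2.
have A0 : 0 <= s - t ^+ 2 / th.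
  have [] := H 1 0; rewrite subr_ge0 ler_pdivrMr//; lra.
(* The new scale splits as [N] plus the remainder in [bq], and the new form as (1 - be) z^2 th + q.
   The pairs are controlled by [tbe] and by [bq]. *)
pose N := (t ^+ 2 - be ^+ 2 * de ^+ 2) / th.
have NE : s - th^-1 * be ^+ 2 * de ^+ 2 = N + (s - t ^+ 2 / th).
  by rewrite /N; field.
have rE : r - th^-1 * be * a ^+ 2 = (1 - be) * z ^+ 2 * th + q.
  by rewrite /q az; field.
have -> : g - th^-1 * be * de * a = z * (t - be * de) + b.
  by rewrite /b az; field.
rewrite NE rE; apply: sqrD_leM => //.
- by rewrite divr_ge0// ltW.
- apply: mulr_ge0 (ltW th0); apply: mulr_ge0 (sqr_ge0 _).
  by rewrite subr_ge0; case/andP: be01.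
- have -> : N * ((1 - be) * z ^+ 2 * th) =
      z ^+ 2 * ((1 - be) * (t ^+ 2 - be ^+ 2 * de ^+ 2)).
    by rewrite /N; field.
  by rewrite exprMn ler_wpM2l ?sqr_ge0.
Qed.

(** * Prediction: image of the ellipsoid plus the noise zonotope *)

Lemma dotv_mulZ (R : realType) (n : nat) (u v : 'cV[R]_n) (a : R) (P : 'M[R]_n) :
  dotv u ((a *: P) *m v) = a * dotv u (P *m v).
Proof. by rewrite -scalemxAl dotvZr. Qed.

Lemma dotv_dyad (R : realType) (n : nat) (u f : 'cV[R]_n) :
  dotv u ((f *m f^T) *m u) = dotv u f ^+ 2.
Proof.
rewrite -mulmxA [f^T *m u]mx11_scalar mul_mx_scalar dotvZr -/(dotv f u).
by rewrite (dotvC f).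
Qed.

Lemma mulmx_sum_col (R : realType) (n m : nat) (A : 'M[R]_(n, m)) (v : 'cV[R]_m) :
  A *m v = \sum_i v i 0 *: col i A.
Proof.
apply/colP => i; rewrite mxE summxE; apply: eq_bigr => j _.
by rewrite !mxE mulrC.
Qed.

Lemma psd_trace_ge0 (R : realType) (n : nat) (P : 'M[R]_n) :
  psdmx P -> 0 <= \tr P.
Proof.
move=> [_ P0]; apply: sumr_ge0 => i _; have := P0 (delta_mx i 0).
by rewrite /dotv -colE trmx_delta -rowE !mxE.
Qed.

Lemma psd_conj (R : realType) (m n : nat) (A : 'M[R]_(m, n)) (P : 'M[R]_n) :
  psdmx P -> psdmx (A *m P *m A^T).
Proof.
move=> [Psym P0]; split; first by rewrite !trmx_mul trmxK Psym mulmxA.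
by move=> v; rewrite -!mulmxA dotv_mulmx.
Qed.

(** [Num.sqrt] is 0 at negative arguments. This yields a positive scale from a nonzero [mubar0] or
    lambda, and a positive theta from the latter. *)
Lemma sqrtr_mul_neq0 (R : rcfType) (s a : R) :
  0 <= a -> Num.sqrt (s * a) != 0 -> 0 < s.
Proof.
by move=> a0; rewrite sqrtr_eq0 -ltNge => sa; nra.
Qed.

Section Prediction.
Context (R : realType) (n l m : nat) (d : model R n l m).
Implicit Types (e : estimate R n).

Lemma est_ellipsoidP e x : psdmx (shp e) ->
  est_ellipsoid e x <->
  forall u, dotv u (x - ctr e) ^+ 2 <= scl e * dotv u (shp e *m u).
Proof.
move=> [Psym _]; rewrite /est_ellipsoid ellipsoidP linearZ /= Psym.
by split=> [[_ H] u|H]; [|split=> // u]; have := H u; rewrite dotv_mulZ.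
Qed.

Lemma Rbar_sym k : (Rbar d k)^T = Rbar d k.
Proof.
rewrite /Rbar linear_sum; apply: eq_bigr => i _.
by rewrite linearZ /= trmx_mul trmxK.
Qed.

Lemma dotv_Rbar k u : dotv u (Rbar d k *m u) =
  \sum_i (enorm (col i (Rmx d k)))^-1 * dotv u (col i (Rmx d k)) ^+ 2.
Proof.
rewrite /Rbar mulmx_suml dotv_sumr; apply: eq_bigr => i _.
by rewrite dotv_mulZ dotv_dyad.
Qed.

Lemma dotv_Rbar_ge0 k u : 0 <= dotv u (Rbar d k *m u).
Proof.
rewrite dotv_Rbar sumr_ge0// => i _.
by rewrite mulr_ge0 ?sqr_ge0// invr_ge0 enorm_ge0.
Qed.

Lemma mubar_ge0 k : 0 <= mubar d k.
Proof. by apply: sumr_ge0 => i _; exact: enorm_ge0. Qed.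

(** Cauchy-Schwarz with weights |r_i| and (u . r_i)^2 / |r_i|: the zonotope lies in the ellipsoid of
    shape [mubar * Rbar] centred at 0. *)
Lemma dotv_noise_le k u (v : 'cV[R]_m) : (forall a, -1 <= v a 0 <= 1) ->
  (forall i, col i (Rmx d k) != 0) ->
  dotv u (Rmx d k *m v) ^+ 2 <= mubar d k * dotv u (Rbar d k *m u).
Proof.
move=> v1 R0; rewrite mulmx_sum_col dotv_sumr dotv_Rbar.
apply: sqr_sum_leM => i; first exact: enorm_ge0.
  by rewrite mulr_ge0 ?sqr_ge0// invr_ge0 enorm_ge0.
rewrite mulrA divff ?mul1r; last first.
  by rewrite sqrtr_eq0 -ltNge lt_def dotvv_ge0 dotvv_eq0 R0.
rewrite dotvZr exprMn ler_piMl ?sqr_ge0//.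
by have /andP[? ?] := v1 i; nra.
Qed.

Lemma predict_sound k e x (v : 'cV[R]_m) :
  (forall i, col i (Rmx d k) != 0) -> (forall a, -1 <= v a 0 <= 1) ->
  psdmx (shp e) -> mubar0 d k e != 0 -> est_ellipsoid e x ->
  psdmx (shp (predict d k e)) /\
  est_ellipsoid (predict d k e)
    (Amx d k *m x + Bmx d k *m tau d k + Rmx d k *m v).
Proof.
move=> R0 v1 Ppsd mu0 xe.
have P0psd : psdmx (pred_shp0 d k e) := psd_conj (Amx d k) Ppsd.
have s0 : 0 < scl e := sqrtr_mul_neq0 (psd_trace_ge0 P0psd) mu0.
have {}mu0 : 0 < mubar0 d k e by rewrite lt_def mu0 sqrtr_ge0.
have c0 : 0 <= mubar d k / mubar0 d k e by rewrite divr_ge0 ?mubar_ge0 ?ltW.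
have qE u : dotv u (shp (predict d k e) *m u) = (1 + mubar d k / mubar0 d k e) *
    (dotv u (pred_shp0 d k e *m u) + (mubar0 d k e / scl e) * dotv u (Rbar d k *m u)).
  by rewrite dotv_mulZ mulmxDl dotvDr dotv_mulZ.
have predpsd : psdmx (shp (predict d k e)).
  split; first by rewrite /= linearZ linearD linearZ /= Rbar_sym P0psd.1.
  move=> u; rewrite qE mulr_ge0 ?addr_ge0// ?P0psd.2//.
  by rewrite mulr_ge0 ?dotv_Rbar_ge0// divr_ge0 ?ltW.
split=> //; apply/est_ellipsoidP => // u; rewrite qE /=.
have -> : Amx d k *m x + Bmx d k *m tau d k + Rmx d k *m v -
    (Amx d k *m ctr e + Bmx d k *m tau d k) =
    Amx d k *m (x - ctr e) + Rmx d k *m v.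
  by rewrite mulmxBr; apply/colP => i; rewrite !mxE; ring.
(* Distributing the scale turns the bound into (1 + mubar/mubar0)(s X + mubar0 q), to which
   [sqrD_leM] applies with N = 1 and A = mubar/mubar0. *)
rewrite dotvDr mulrCA mulrDr mulrA [_ * (_ / _)]mulrC divfK ?gt_eqF//.
apply: sqrD_leM => //.
- by rewrite mulr_ge0 ?P0psd.2// ltW.
- by rewrite mulr_ge0 ?dotv_Rbar_ge0// ltW.
- rewrite mul1r dotv_mulmx -!mulmxA [in leRHS]dotv_mulmx.
  exact: ((est_ellipsoidP x Ppsd).1 xe).
- by rewrite mulrA divfK ?gt_eqF// dotv_noise_le.
Qed.

End Prediction.

(** * Correction: one measurement at a time *)

(** When [be] is nonzero, [be * de] is the endpoint of [de - ga, de + ga] nearest to 0, so [t] is at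
    least as far from 0 and on the same side. *)
Lemma beta_bounds (R : realFieldType) (t de ga : R) (b1 b2 : bool) :
  de - ga <= t <= de + ga -> (b1 -> ga = 0) ->
  let be := if b1 then 1
            else if (ga < `|de|) && b2 then 1 - ga * `|de|^-1 else 0 in
  [/\ 0 <= be <= 1, 0 <= t ^+ 2 - be ^+ 2 * de ^+ 2
    & (t - be * de) ^+ 2 <= (1 - be) * (t ^+ 2 - be ^+ 2 * de ^+ 2)].
Proof.
move=> /andP[t1 t2] b1ga /=; case: b1 b1ga => [/(_ isT) ga0|_].
  by rewrite subrr mul0r (_ : t = de) ?lexx ?ler01; [split=> //; nra|lra].
case: ifP => [/andP[gade _]|_]; last first.
  by rewrite expr0n /= !mul0r !subr0 mul1r lexx ler01; split=> //; nra.
have de0 : 0 < `|de| by lra.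
set r := ga * _.
have rE : r * `|de| = ga by rewrite divfK ?gt_eqF.
have r01 : 0 <= r < 1 by rewrite divr_ge0 ?ltr_pdivrMr ?mul1r//; lra.
have {r01}[r0 r1] := andP r01; pose w := (1 - r) * de.
(* The endpoints are [w] and 2 de - w, and [t] lies between them; both cases of the sign of [de]
   give these products. *)
have [tw dtw] : 0 <= (t - w) * (t + w) /\ 0 <= (t - w) * (2 * de - t - w).
  move: rE gade; case: (ger0P de) => _ rE gade.
    have wE : w = de - ga by rewrite /w; lra.
    by rewrite wE; split; apply: mulr_ge0; lra.
  have wE : w = de + ga by rewrite /w; lra.
  by rewrite wE; split; apply: mulr_le0; lra.
split; first by apply/andP; split; lra.
  by rewrite -exprMn -/w; lra.
rewrite -exprMn -/w -subr_ge0.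
have -> : (1 - (1 - r)) * (t ^+ 2 - w ^+ 2) - (t - w) ^+ 2 =
    (1 - r) * ((t - w) * (2 * de - t - w)) by rewrite /w; ring.
by apply: mulr_ge0 => //; lra.
Qed.

(** The actual value [t] encloses the clipped bound between two reals, so it is finite and [fine] is
    faithful. *)
Lemma fine_clip_ub (R : realType) (h : \bar R) (t r : R) : (t%:E <= h)%E -> t <= r ->
  t <= fine (Order.min h r%:E) <= r.
Proof.
move=> th tr; have lo : (t%:E <= Order.min h r%:E)%E by rewrite le_min th lee_fin.
have hi : (Order.min h r%:E <= r%:E)%E by rewrite ge_min lexx orbT.
by case: (Order.min h r%:E) lo hi => [q||]//=; rewrite !lee_fin => -> ->.
Qed.

Lemma fine_clip_lb (R : realType) (h : \bar R) (t r : R) : (h <= t%:E)%E -> r <= t ->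
  r <= fine (Order.max h r%:E) <= t.
Proof.
move=> th tr; have lo : (Order.max h r%:E <= t%:E)%E by rewrite ge_max th lee_fin.
have hi : (r%:E <= Order.max h r%:E)%E by rewrite le_max lexx orbT.
by case: (Order.max h r%:E) lo hi => [q||]//=; rewrite !lee_fin => -> ->.
Qed.

(** Here [w] stands for x - c. [shrink_scalar] is applied to every [u], its quadratic form being
    that of [P] on x f + y u. *)
Lemma shrink_sound (R : realType) (n : nat) (P : 'M[R]_n) (f w : 'cV[R]_n) (s be de : R)
    (phi := P *m f) (th := dotv f phi) (t := dotv f w)
    (P' : 'M[R]_n := P - (th^-1 * be) *: (phi *m phi^T)) :
  psdmx P -> 0 < th ->
  (forall u, dotv u w ^+ 2 <= s * dotv u (P *m u)) ->
  0 <= be <= 1 -> 0 <= t ^+ 2 - be ^+ 2 * de ^+ 2 ->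
  (t - be * de) ^+ 2 <= (1 - be) * (t ^+ 2 - be ^+ 2 * de ^+ 2) ->
  psdmx P' /\
  (forall u, dotv u (w - (th^-1 * be * de) *: phi) ^+ 2 <=
             (s - th^-1 * be ^+ 2 * de ^+ 2) * dotv u (P' *m u)).
Proof.
move=> [Psym P0] th0 wP be01 N0 tbe.
have qE u : dotv u (P' *m u) =
    dotv u (P *m u) - th^-1 * be * dotv u phi ^+ 2.
  by rewrite mulmxBl dotvBr dotv_mulZ dotv_dyad.
have comb u x y : dotv (x *: f + y *: u) (P *m (x *: f + y *: u)) =
    x ^+ 2 * th + 2 * x * y * dotv u phi + y ^+ 2 * dotv u (P *m u).
  have fPu : dotv f (P *m u) = dotv u phi by rewrite dotv_mulmx Psym dotvC.
  rewrite mulmxDr -!scalemxAr !dotvDr !dotvDl !dotvZl !dotvZr fPu -/phi -/th.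
  by ring.
split.
  split=> [|u]; first by rewrite linearB linearZ /= trmx_mul trmxK Psym.
  (* Testing [P] on the P-orthogonal remainder of [u] gives u.Pu >= (u.phi)^2 / th, and be <= 1 then
     leaves the downdate nonnegative. *)
  have := P0 ((- (dotv u phi / th)) *: f + 1 *: u); rewrite comb qE.
  have [a aE] : exists a, dotv u phi = a * th.
    by exists (dotv u phi / th); rewrite divfK// gt_eqF.
  have thN0 := lt0r_neq0 th0.
  rewrite aE mulfK//.
  have -> : th^-1 * be * (a * th) ^+ 2 = be * (a ^+ 2 * th) by field.
  have : 0 <= a ^+ 2 * th by rewrite mulr_ge0 ?sqr_ge0 ?ltW.
  case/andP: be01; nra.
move=> u; rewrite qE dotvBr dotvZr; apply: (shrink_scalar (t := t)) => // x y.
rewrite -comb; split; first exact: P0.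
by have := wP (x *: f + y *: u); rewrite dotvDl !dotvZl.
Qed.

Section Correction.
Context (R : realType) (n l m : nat) (d : model R n l m).
Implicit Types (e : estimate R n).

Lemma correct1_sound k e (i : 'I_(nmeas d k)) x :
  psdmx (shp e) -> est_ellipsoid e x ->
  (ylo i <= (dotv (fmeas i) x)%:E <= yhi i)%E ->
  psdmx (shp (correct1 e i)) /\ est_ellipsoid (correct1 e i) x.
Proof.
move=> Ppsd xe /andP[xlo xhi].
have xeP := (est_ellipsoidP x Ppsd).1 xe.
rewrite /correct1; set f := fmeas i in xlo xhi *; set phi := shp e *m f.
set th := dotv f phi; set la := Num.sqrt _; set rh := la + _.
set rl := 2 * la - rh; set yh := fine (Order.min _ _); set yl := fine (Order.max _ _).
set de := (yh + yl - rh + rl) / 2; set ga := (yh - yl) / 2.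
set al := (if _ then _ else _); set be := (if _ then _ else _).
(* If lambda is 0, alpha is 0 and the pass changes nothing. *)
have [la0|laN0] := eqVneq la 0.
  have -> : al = 0 by rewrite /al la0 eqxx.
  by rewrite !mul0r !scale0r !subr0 addr0; case: (e) Ppsd xe.
have th_ge0 : 0 <= th by apply: Ppsd.2.
have s0 : 0 < scl e := sqrtr_mul_neq0 th_ge0 laN0.
have th0 : 0 < th by apply: (@sqrtr_mul_neq0 _ _ (scl e)); rewrite ?ltW 1?mulrC.
have alE : al = th^-1 by rewrite /al laN0.
have tla : dotv f (x - ctr e) ^+ 2 <= la ^+ 2.
  by rewrite sqr_sqrtr ?mulr_ge0 ?(ltW s0)//; exact: xeP.
have la_ge0 : 0 <= la by exact: sqrtr_ge0.
(* The support form at u = f: f . x lies in [-rl, rh], so clipping to this range keeps it. *)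
have /andP[tlo thi] : - la <= dotv f (x - ctr e) <= la.
  by rewrite -ler_norml -ler_sqr ?nnegrE// real_normK ?num_real.
move: tlo thi; rewrite dotvBr => tlo thi.
have /andP[h1 h2] : dotv f x <= yh <= rh.
  by apply: fine_clip_ub => //; rewrite /rh; lra.
have /andP[l1 l2] : - rl <= yl <= dotv f x.
  by apply: fine_clip_lb => //; rewrite /rl /rh; lra.
(* de - ga and de + ga are [yl] and [yh] shifted by f . c. *)
have tde : de - ga <= dotv f (x - ctr e) <= de + ga.
  by rewrite dotvBr /de /ga /rl /rh; apply/andP; split; lra.
have ga0 : (yl == yh) && (- rl != rh) -> ga = 0.
  by move=> /andP[/eqP yE _]; rewrite /ga yE subrr mul0r.
have [be01 N0 tbe] := beta_bounds ((- rl < yl) || (yh < rh)) tde ga0.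
have [P'psd xP'] := shrink_sound Ppsd th0 xeP be01 N0 tbe.
rewrite alE; split=> //; apply/est_ellipsoidP => // u /=.
by rewrite opprD addrA; exact: xP'.
Qed.

Lemma correct_sound k e x :
  (forall i : 'I_(nmeas d k), (ylo i <= (dotv (fmeas i) x)%:E <= yhi i)%E) ->
  psdmx (shp e) -> est_ellipsoid e x ->
  psdmx (shp (correct d k e)) /\ est_ellipsoid (correct d k e) x.
Proof.
move=> xm; rewrite /correct; elim: (enum _) e => [//|i s IH] e Ppsd xe /=.
by have [? ?] := correct1_sound Ppsd xe (xm i); exact: IH.
Qed.

(** The four classes cover all indices, and an infinite side is trivial. This makes the correction
    applicable to any point of S_k, beyond the true state. *)
Lemma setS_meas k x : standing_assumptions d -> (0 < k)%N -> setS d k x ->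
  forall i : 'I_(nmeas d k), (ylo i <= (dotv (fmeas i) x)%:E <= yhi i)%E.
Proof.
move=> sa k0 [[[_ xG] xD] xH] i.
have : i \in [set: 'I_(nmeas d k)]%SET by rewrite inE.
rewrite -(meas_classes sa k0) !finset.in_setU => /orP[/orP[/orP[]|]|] Hi.
- have := xD i Hi; move: Hi; rewrite inE => /and3P[lo hi _].
  by rewrite /measD /= -!lee_fin !fineK.
- have := xG i; rewrite /= /measG finset.in_setU Hi => /(_ isT).
  move: Hi; rewrite inE => /andP[/eqP -> hi].
  by rewrite /halfspace /= -lee_fin fineK// dotvC leNye.
- have := xG i; rewrite /= /measG finset.in_setU Hi orbT => /(_ isT).
  move: (Hi); rewrite inE => /andP[/eqP hi lo].
  rewrite inE hi andbF /halfspace /= -scaleN1r dotvZr mulN1r lerN2 dotvC.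
  by rewrite -lee_fin fineK// leey andbT.
- have := xH i Hi; move: Hi; rewrite inE => /andP[/eqP lohi lo].
  by rewrite /measH /hyperplane /= dotvC lohi => ->; rewrite fineK -?lohi// lexx.
Qed.

Lemma meas_setS k x :
  est_ellipsoid (predict d k.-1 (filter_est d k.-1)) x ->
  (forall i : 'I_(nmeas d k), (ylo i <= (dotv (fmeas i) x)%:E <= yhi i)%E) ->
  setS d k x.
Proof.
move=> xE xm; split; [split; [split=> //|]|] => i /= Hi;
  have /andP[lo hi] := xm i.
- rewrite /measG; case: ifPn => Hup.
    move: Hup; rewrite inE => /andP[_ fhi].
    by rewrite /halfspace /= -lee_fin fineK// dotvC.
  move: Hi; rewrite finset.in_setU (negPf Hup) inE => /andP[_ flo].
  by rewrite /halfspace /= -scaleN1r dotvZr mulN1r lerN2 dotvC -lee_fin fineK.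
- move: Hi; rewrite inE => /and3P[flo fhi _].
  by rewrite /measD /= -!lee_fin !fineK// lo.
- move: Hi; rewrite inE => /andP[/eqP lohi flo].
  rewrite /measH /hyperplane /= dotvC; move: lo hi flo; rewrite lohi.
  case: (yhi i) => [q||]//=; rewrite !lee_fin => lo hi _.
  by apply/eqP; rewrite eq_le hi lo.
Qed.

End Correction.

(** * Induction over time, then the inclusion of S_k in E_k *)

Theorem theorem4p7 (R : realType) (n l m : nat) (d : model R n l m)
    (x : nat -> 'cV[R]_n) (nu : nat -> 'cV[R]_m) :
  standing_assumptions d ->
  trajectory d x nu ->
  meets_measurements d x ->
  forall k : nat, (0 < k)%N -> prediction_defined d k ->
    x k \in setS d k /\ setS d k `<=` setE d k.
Proof.
move=> sa [x0 nu1 xrec] xmeas.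
have pred k : psdmx (shp (filter_est d k)) -> setE d k (x k) ->
    mubar0 d k (filter_est d k) != 0 ->
    psdmx (shp (predict d k (filter_est d k))) /\
    est_ellipsoid (predict d k (filter_est d k)) (x k.+1).
  move=> Ppsd xk mu0; rewrite xrec//=.
  by apply: predict_sound => // i; exact: Rmx_col_neq0.
(* Membership is carried together with positive semi-definiteness of the shape, which
   [est_ellipsoidP] requires at the next step. *)
have inv k : prediction_defined d k ->
    psdmx (shp (filter_est d k)) /\ setE d k (x k).
  elim: k => [_|k IH def].
    split; last by move: x0; rewrite inE.
    have [Psym Ppos] := Pinit_pd sa; split=> // v.
    by have [->|/Ppos/ltW//] := eqVneq v 0; rewrite mulmx0 dotv0.
  have [|Ppsd xk] := IH; first by move=> j jk; apply: def; exact: ltnW.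
  have [] := pred k Ppsd xk (def k (ltnSn k)).
  by apply: correct_sound; exact: xmeas.
case=> // k _ def.
have [|Ppsd xk] := inv k; first by move=> j jk; apply: def; exact: ltnW.
have [P'psd xk1] := pred k Ppsd xk (def k (ltnSn k)).
split; first by rewrite inE; apply: meas_setS => //; exact: xmeas.
(* The point [y] lies in the predicted ellipsoid and meets every measurement, which is all that
   [correct_sound] asks of a point. *)
move=> y yS; have ym := setS_meas sa (ltn0Sn k) yS.
by case: yS => [[[yE _] _] _]; have [] := correct_sound ym P'psd yE.
Qed.
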